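(* Let $n\ge 1$ be an integer and let the secret $\sigma\in S_n$ be uniformly random. Given a strategy $\mathcal{S}$ for Permutation Wordle on $[n]$, possibly randomized, let $P_r(\mathcal{S})$ denote the probability that $\mathcal{S}$ solves $\sigma$ within $r$ guesses. Then $P_r(\text{CircularShift})\ge P_r(\mathcal{S})$ for every integer $r\ge 1$ and every strategy $\mathcal{S}$.
   Context: Let $[n]=\{1,\dots,n\}$ and let $S_n$ be the group of permutations of $[n]$. Permutation Wordle: a setter fixes a secret $\sigma\in S_n$. In round $r=1,2,\dots$ the guesser submits a word $\gamma_r\in[n]^n$ (not necessarily a permutation), regarded as a function $\gamma_r:[n]\to[n]$ from positions to values, and receives the feedback $U_r=\{i\in[n] : \gamma_r(i)=\sigma(i)\}$. A deterministic strategy is a rule specifying, for each $r\ge 1$, the guess $\gamma_r\in[n]^n$ as a function of the previous feedback $(U_1,\dots,U_{r-1})$. A randomized strategy may in addition use internal coin flips that are independent of the secret; equivalently, it is a random choice of deterministic strategy, made independently of $\sigma$. A strategy solves $\sigma$ within $r$ guesses if $\gamma_j=\sigma$ for some $1\le j\le r$. CircularShift is the following deterministic strategy. The first guess $\gamma_1$ is the identity permutation. After submitting $\gamma_r$ and receiving $U_r$: if $U_r=[n]$, stop (the secret is solved in $r$ rounds). Otherwise write $[n]\setminus U_r=\{a_1<\cdots<a_\ell\}$ and define $\gamma_{r+1}(i)=\gamma_r(i)$ if $i\in U_r$; $\gamma_{r+1}(a_j)=\gamma_r(a_{j-1})$ for $1<j\le \ell$; and $\gamma_{r+1}(a_1)=\gamma_r(a_\ell)$.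 *)

(* Defs.v *)
From mathcomp Require Import all_boot all_order all_fingroup all_algebra.
From mathcomp Require Import all_classical all_reals all_analysis.

Set Implicit Arguments.
Unset Strict Implicit.
Unset Printing Implicit Defensive.

Import Order.TTheory GRing.Theory Num.Theory.

Local Open Scope classical_set_scope.
Local Open Scope ring_scope.

(* Positions and values are 0-based: 'I_n plays the role of
   [n]. Guesses are arbitrary words, secrets are permutations. *)
Definition guess (n : nat) : Type := {ffun 'I_n -> 'I_n}.

(* The r-th guess is the value at the chronological list [:: U_1; ...; U_(r-1)]
   of the feedback received so far. *)
Definition strategy (n : nat) : Type := seq {set 'I_n} -> guess n.

Definition feedback (n : nat) (g : guess n) (s : 'S_n) : {set 'I_n} :=
  [set i | g i == s i]%SET.

(* The feedback U_1, ..., U_r produced by the first r rounds against s. *)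
Fixpoint history (n : nat) (S : strategy n) (s : 'S_n) (r : nat) :
    seq {set 'I_n} :=
  if r is r'.+1 then
    let h := history S s r' in rcons h (feedback (S h) s)
  else [::].

(* Rounds are numbered from 1, so this is meaningful for r >= 1 only. *)
Definition nth_guess (n : nat) (S : strategy n) (s : 'S_n) (r : nat) :
    guess n :=
  S (history S s r.-1).

Definition solves_within (n : nat) (S : strategy n) (s : 'S_n) (r : nat) :
    Prop :=
  exists2 j : nat, (1 <= j <= r)%N & nth_guess S s j =1 s.

(* enum (~: U) lists the complement of U in increasing order as a_1, ..., a_l,
   and prev is the predecessor in that list read cyclically: it sends a_j to
   a_(j-1) for j > 1, and a_1 to a_l. *)
Definition shift_guess (n : nat) (g : guess n) (U : {set 'I_n}) : guess n :=
  [ffun i => if i \in U then g i else g (prev (enum (~: U)%SET) i)].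

(* Stopping once U_r = [n] is rendered by repeating the (correct) guess, which
   does not affect solves_within. *)
Definition circular_shift (n : nat) : strategy n :=
  foldl (@shift_guess n) [ffun i => i].
Arguments circular_shift : clear implicits.

Section RandomPlay.
Context {R : realType} {d : measure_display} {T : measurableType d}.
Variable (P : probability T R).

Definition uniform_secret (n : nat) (secret : T -> 'S_n) : Prop :=
  forall s : 'S_n, measurable (secret @^-1` [set s]) /\
    P (secret @^-1` [set s]) = ((n`!)%:R^-1)%:E.

(* Events that fix the answer of a random strategy to one feedback list. *)
Definition strategy_cylinders (n : nat) (S : T -> strategy n) : set (set T) :=
  [set A | exists h : seq {set 'I_n}, exists g : guess n,
     A = [set t | S t h = g]].

(* Measurability of S for the product sigma-algebra on strategies. *)
Definition random_strategy (n : nat) (S : T -> strategy n) : Prop :=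
  strategy_cylinders S `<=` measurable.

(* <<s strategy_cylinders S >> is the sigma-algebra generated by S. *)
Definition independent_of_secret (n : nat) (secret : T -> 'S_n)
    (S : T -> strategy n) : Prop :=
  forall (B : set 'S_n) (A : set T), <<s strategy_cylinders S >> A ->
    P (secret @^-1` B `&` A) = (P (secret @^-1` B) * P A)%E.

Definition solve_probability (n : nat) (secret : T -> 'S_n)
    (S : T -> strategy n) (r : nat) : \bar R :=
  P [set t | solves_within (S t) (secret t) r].

End RandomPlay.

(* Main.v *)
Require Import Defs.
From mathcomp Require Import all_boot all_order all_fingroup all_algebra.
From mathcomp Require Import all_classical all_reals all_analysis.
From mathcomp Require Import measurable_realfun zify.

(** Averaging over the coins of the guesser reduces the theorem to counting: if
    [solved S r] is the set of secrets that the deterministic strategy [S]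
    solves within [r] guesses, then [solved S r] is never larger than
    [solved (circular_shift n) r].

    The count rests on an inequality between two arbitrary strategies, proved
    by the polynomial method:
      #|solved S a| + #|solved S' b| <= n! whenever a, b > 0 and a + b <= n
    ([card_solved_complementary]).  To each [s] solved within [a] guesses
    corresponds the function [separator S a s] on S_n, the product over the
    positions [i] and the wrong guesses at [i] during the first [a - 1] rounds
    played against [s] of (x_i - guessed value), where x_i is the value of the
    permutation at [i].  It does not vanish at [s]; at another solved secret
    [s'] it can only be nonzero if the two games first differ in a round in
    which [s'] gets strictly fewer hits than [s].  Hence the separators of the
    solved secrets form a triangular, so linearly independent, family
    ([separator_mx_free]).  They have degree at most a - 1 in each x_i, and the
    signed sum over S_n of a product of one-variable polynomials
    Q_0(x_0) ... Q_(n-1)(x_(n-1)) is det (Q_i(v))_(i, v), which is 0 when all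
    the degrees are at most n - 2.  The separators of [S] with [a] rounds and
    those of [S'] with [b] rounds are therefore orthogonal for the
    nondegenerate form sum_p sgn(p) f(p) g(p), and the dimensions add up to at
    most n!.

    For CircularShift, every round that is not the last one makes exactly one
    value move from the last unsolved position to the first one, and no value
    jumps over its target.  So a secret [s] is solved after at most as many
    extra rounds as there are values that have to wrap around, that is,
    elements of [anti_excedances s^-1] ([circular_shift_solves]).  Composing
    s^-1 with the cyclic successor turns k anti-excedances into n - 1 - k.
    So, for r < n, the permutations with fewer than r anti-excedances and
    those with fewer than n - r are together n! in number: CircularShift
    attains equality above with a = r and b = n - r, and no strategy can solve
    more secrets within [r] guesses ([card_solved_circular_shift]). *)

Set Implicit Arguments.
Unset Strict Implicit.
Unset Printing Implicit Defensive.

Import Order.TTheory GRing.Theory Num.Theory.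

Local Open Scope ring_scope.

(** * Linear algebra *)

(** In a vanishing combination of the rows, look at the row of maximal weight
    among those with a nonzero coefficient: in its own column [c i] all the
    others vanish. *)
Lemma triangular_row_free (F : fieldType) (m n : nat) (A : 'M[F]_(m, n))
    (c : 'I_m -> 'I_n) (w : 'I_m -> nat) :
  (forall i, A i (c i) != 0) ->
  (forall i j, i != j -> A i (c j) != 0 -> (w j < w i)%N) ->
  row_free A.
Proof.
move=> Adiag Atri; apply: inj_row_free => v vA0.
apply/rowP => i0; rewrite mxE; apply/eqP; apply: contraT => vi0.
case: (@arg_maxnP _ i0 (fun i => v 0 i != 0) w vi0) => i vi wmax.
have /eqP := congr1 (fun u : 'rV_n => u 0 (c i)) vA0.
rewrite !mxE (bigD1 i) //= big1 => [|j ji].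
  by rewrite addr0 mulf_eq0 (negbTE vi) (negbTE (Adiag i)).
case: (eqVneq (v 0 j) 0) => [->|vj]; first by rewrite mul0r.
case: (eqVneq (A j (c i)) 0) => [->|Aj]; first by rewrite mulr0.
by have := wmax j vj; rewrite /= leqNgt Atri.
Qed.

(** The matrix factors through a space of dimension n - 1, as the coefficients
    of the [Q i] times a Vandermonde matrix. *)
Lemma det_horner_low_degree (F : fieldType) (n : nat) (Q : 'I_n -> {poly F})
    (y : 'I_n -> F) :
  (0 < n)%N -> (forall i, size (Q i) < n)%N ->
  \det (\matrix_(i, j) (Q i).[y j]) = 0.
Proof.
move=> n_gt0 szQ; set M := (X in \det X).
pose C := \matrix_(i < n, k < n.-1) (Q i)`_k.
pose V := \matrix_(k < n.-1, j < n) y j ^+ k.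
have -> : M = C *m V.
  apply/matrixP => i j; rewrite !mxE (@horner_coef_wide _ n.-1); last first.
    by have := szQ i; case: (n).
  by apply: eq_bigr => k _; rewrite !mxE.
apply/eqP; apply: contraT => detN.
have := mxrankM_maxr C V.
rewrite mxrank_unit ?unitmxE ?unitfE // => rk.
have := leq_trans rk (rank_leq_row _).
by rewrite leqNgt ltn_predL n_gt0.
Qed.

(** * Separating polynomials of the solved secrets *)

Definition solved (n : nat) (S : strategy n) (r : nat) : {set 'S_n} :=
  [set s | `[< solves_within S s r >]]%SET.

Lemma history_prefix (n : nat) (S : strategy n) (s s' : 'S_n) (k l : nat) :
  (k <= l)%N -> history S s l = history S s' l ->
  history S s k = history S s' k.
Proof.
move=> kl; elim: l kl => [|l IHl]; first by rewrite leqn0 => /eqP ->.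
rewrite leq_eqVlt ltnS => /predU1P[-> //|kl] /= /rcons_inj[hh _].
exact: IHl.
Qed.

(** A guess that solves [s] before round [r] appears among the first [r - 1]
    feedbacks as a full set of hits. *)
Lemma solved_before_last (n : nat) (S : strategy n) (s s' : 'S_n) (r j : nat) :
  (0 < j < r)%N -> nth_guess S s j =1 s ->
  history S s r.-1 = history S s' r.-1 -> s = s'.
Proof.
case: j => // j /= jr gs.
have jr' : (j.+1 <= r.-1)%N by rewrite -ltnS; case: r jr.
move=> /(history_prefix jr')/= /rcons_inj[hh ff].
apply/permP => i; rewrite -gs /nth_guess /= hh.
have: i \in feedback (S (history S s j)) s by rewrite inE -gs.
by rewrite ff -hh inE => /eqP; rewrite hh.
Qed.

(** The guess of round [r] is determined by [r - 1] feedbacks, so these tell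
    apart any two secrets solved within [r] guesses. *)
Lemma solved_history_inj (n : nat) (S : strategy n) (r : nat) :
  {in solved S r &, injective (fun s => history S s r.-1)}.
Proof.
move=> s s'; rewrite !inE => -[j /andP[j0 jr] gj] [j' /andP[j'0 j'r] gj'] /= hh.
have [jr1|rj] := ltnP j r.
  by apply: solved_before_last gj hh; rewrite j0.
have [jr1|rj'] := ltnP j' r.
  by apply/esym; apply: solved_before_last gj' (esym hh); rewrite j'0.
have Ej : j = r by apply/eqP; rewrite eqn_leq jr.
have Ej' : j' = r by apply/eqP; rewrite eqn_leq j'r.
by apply/permP => i; rewrite -gj -gj' Ej Ej' /nth_guess hh.
Qed.

(** Values are turned into distinct numbers, so that a wrong guess can be the
    root of a polynomial. *)
Definition node (n : nat) (v : 'I_n) : rat := (v : nat)%:R.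

Lemma node_inj n : injective (@node n).
Proof. by move=> u v /eqP; rewrite eqr_nat => /eqP/val_inj. Qed.

(** The guess of round [r] itself is left out: [r - 1] rounds already tell the
    secrets apart, and this keeps the degree below [r]. *)
Definition miss_poly (n : nat) (S : strategy n) (r : nat) (s : 'S_n)
    (i : 'I_n) : {poly rat} :=
  \prod_(1 <= j < r | nth_guess S s j i != s i)
    ('X - (node (nth_guess S s j i))%:P).

Lemma size_miss_poly (n : nat) (S : strategy n) (r : nat) (s : 'S_n)
    (i : 'I_n) :
  (0 < r)%N -> (size (miss_poly S r s i) <= r)%N.
Proof.
move=> r0; rewrite /miss_poly -big_filter size_prod_XsubC size_filter.
by rewrite (leq_ltn_trans (count_size _ _)) // size_iota subn1 prednK.
Qed.

Definition separator (n : nat) (S : strategy n) (r : nat) (s p : 'S_n) : rat :=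
  \prod_i (miss_poly S r s i).[node (p i)].

(** [p] avoids the roots exactly when none of the wrong guesses made against
    [s] would have been a hit against [p]. *)
Lemma separator_neq0 (n : nat) (S : strategy n) (r : nat) (s p : 'S_n) :
  reflect (forall i j, (0 < j < r)%N -> nth_guess S s j i = p i ->
             nth_guess S s j i = s i)
          (separator S r s p != 0).
Proof.
apply: (iffP idP) => [sep i j jr gp|H].
  move: sep; apply: contra_neq_eq => gs.
  apply/eqP/prodf_eq0; exists i => //.
  rewrite horner_prod prodf_seq_eq0; apply/hasP; exists j.
    by rewrite mem_index_iota.
  by rewrite gs !hornerE gp subrr eqxx.
apply/prodf_neq0 => i _; rewrite horner_prod prodf_seq_neq0.
apply/allP => j; rewrite mem_index_iota => jr; apply/implyP.
rewrite !hornerE subr_eq0; apply: contra_neq => /node_inj gp.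
exact: H.
Qed.

(** The number with digits #|U_1|, #|U_2|, ... in base n + 1.  No digit exceeds
    [n], so for games of the same length comparing scores is comparing
    lexicographically the numbers of hits in each round. *)
Definition score (n : nat) (h : seq {set 'I_n}) : nat :=
  foldl (fun (a : nat) (U : {set 'I_n}) => a * n.+1 + #|U|)%N 0%N h.

Lemma score_rcons (n : nat) (h : seq {set 'I_n}) (U : {set 'I_n}) :
  score (rcons h U) = (score h * n.+1 + #|U|)%N.
Proof. by rewrite /score foldl_rcons. Qed.

(** As long as the games against [s] and [p] agree they get the same guess, and
    nonvanishing says that every hit against [p] is one against [s].  In the
    first round where the feedbacks differ, [p] thus gets fewer hits. *)
Lemma separator_history (n : nat) (S : strategy n) (r k : nat) (s p : 'S_n) :
  (k < r)%N -> separator S r s p != 0 ->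
  history S s k = history S p k \/
  (score (history S p k) < score (history S s k))%N.
Proof.
move=> kr /separator_neq0 H; elim: k kr => [|k IHk] kr; first by left.
case: (IHk (ltnW kr)) => [hh|lt] /=; rewrite ?score_rcons.
  rewrite -hh; set g := S _.
  have sub : feedback g p \subset feedback g s.
    apply/fintype.subsetP => i; rewrite !inE => /eqP gp; apply/eqP.
    exact: (H i k.+1).
  have [<-|ne] := eqVneq (feedback g p) (feedback g s); first by left.
  right; rewrite ltn_add2l; apply: proper_card.
  by rewrite finset.properEneq ne.
(* A deficit in the leading digits outweighs the digit #|U| <= n. *)
right; have := max_card (feedback (S (history S p k)) p).
rewrite card_ord => U_n.
rewrite (@leq_trans ((score (history S p k)).+1 * n.+1)) //.
  by rewrite mulSn addnC ltn_add2r ltnS.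
by rewrite (leq_trans (leq_mul lt (leqnn _))) ?leq_addr.
Qed.

Definition separator_mx (n : nat) (S : strategy n) (r : nat) :
    'M[rat]_(#|solved S r|, #|{: 'S_n}|) :=
  \matrix_(k, l) separator S r (enum_val k) (enum_val l).

Lemma separator_mx_free (n : nat) (S : strategy n) (r : nat) :
  (0 < r)%N -> row_free (separator_mx S r).
Proof.
move=> r0.
apply: (@triangular_row_free _ _ _ _ (fun k => enum_rank (enum_val k))
         (fun k => score (history S (enum_val k) r.-1))) => [k|k l kl].
  by rewrite mxE enum_rankK; apply/separator_neq0.
rewrite mxE enum_rankK => /(@separator_history _ _ _ r.-1) [||//].
  by rewrite prednK.
move=> /(solved_history_inj (enum_valP _) (enum_valP _)) /enum_val_inj E.
by rewrite E eqxx in kl.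
Qed.

(** The sum is a determinant by the Leibniz formula, and its entries are values
    of polynomials of degree at most (a - 1) + (b - 1) <= n - 2. *)
Lemma separator_orthogonal (n : nat) (S S' : strategy n) (a b : nat)
    (s s' : 'S_n) :
  (0 < a)%N -> (0 < b)%N -> (a + b <= n)%N ->
  \sum_(p : 'S_n) (-1) ^+ p * (separator S a s p * separator S' b s' p) = 0.
Proof.
move=> a0 b0 abn.
rewrite -[RHS](@det_horner_low_degree _ n
  (fun i => miss_poly S a s i * miss_poly S' b s' i) (@node n));
  [|by lia|]; last first.
  move=> i; apply: leq_ltn_trans (size_polyMleq _ _) _.
  have := size_miss_poly S s i a0; have := size_miss_poly S' s' i b0.
  move=> Hb Ha; have := leq_trans (leq_add Ha Hb) abn.
  by case: addn => [_|m //]; apply: leq_trans abn; rewrite addn_gt0 a0.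
apply: eq_bigr => p _; congr (_ * _).
rewrite /separator -big_split /=; apply: eq_bigr => i _.
by rewrite mxE hornerM.
Qed.

(** Two independent families that are orthogonal for the nondegenerate form
    with diagonal matrix [D] of signs have at most #|S_n| = n! elements in
    all. *)
Theorem card_solved_complementary (n : nat) (S S' : strategy n) (a b : nat) :
  (0 < a)%N -> (0 < b)%N -> (a + b <= n)%N ->
  (#|solved S a| + #|solved S' b| <= n`!)%N.
Proof.
move=> a0 b0 abn.
pose D : 'M[rat]_#|{: 'S_n}| := diag_mx (\row_l (-1) ^+ (enum_val l : 'S_n)).
have freeD : D \in unitmx.
  rewrite unitmxE det_diag unitfE; apply/prodf_neq0 => l _.
  by rewrite mxE expf_neq0 // oppr_eq0 oner_eq0.
have AB0 : separator_mx S a *m (D *m (separator_mx S' b)^T) = 0.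
  apply/matrixP => k k'; rewrite mul_diag_mx !mxE.
  rewrite -[RHS](separator_orthogonal S S' (enum_val k) (enum_val k')
                   a0 b0 abn).
  rewrite (reindex (fun l : 'I_#|{: 'S_n}| => enum_val l)) /=; last first.
    by apply: onW_bij; exact: enum_val_bij.
  by apply: eq_bigr => l _; rewrite !mxE mulrCA.
have := mulmx0_rank_max AB0.
rewrite (eqP (separator_mx_free S a0)) -mxrank_tr trmx_mul trmxK.
rewrite mxrankMfree ?row_free_unit ?unitmx_tr //.
by rewrite (eqP (separator_mx_free S' b0)) card_Sn.
Qed.

(** * CircularShift and anti-excedances *)

Local Open Scope nat_scope.

Lemma sorted_enum_set (n : nat) (A : {set 'I_n}) :
  sorted (relpre val ltn) (enum A).
Proof.
rewrite -sorted_map -[enum _](eq_filter (mem_enum _)).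
rewrite -(eq_filter (mem_map val_inj _)) -filter_map.
by rewrite (sorted_filter ltn_trans) // unlock val_ord_enum iota_ltn_sorted.
Qed.

(** Read cyclically, the predecessor of [i] in [A] is the greatest element below
    [i], except that the minimum of [A] is preceded by its maximum. *)
Lemma prev_enumP (n : nat) (A : {set 'I_n}) (i : 'I_n) (j := prev (enum A) i) :
  i \in A ->
  (forall k, k \in A -> i <= k /\ k <= j) \/
  (j < i /\ forall k, k \in A -> k < i -> k <= j).
Proof.
move=> iA; rewrite {}/j; have := sorted_enum_set A; have := mem_enum A.
move: (enum A) (enum_uniq A) => e e_uniq e_mem e_sorted.
have lt_nth a b : a < b < size e -> nth i e a < nth i e b.
  case/andP=> ab be.
  have tr : transitive (relpre (@nat_of_ord n) ltn).
    by move=> ? ? ?; apply: ltn_trans.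
  by apply: (sorted_ltn_nth tr i e_sorted); rewrite ?inE // (ltn_trans ab).
have le_nth a b : a <= b < size e -> nth i e a <= nth i e b.
  rewrite leq_eqVlt; case/andP=> /predU1P[->//|ab] be.
  by rewrite ltnW ?lt_nth ?ab.
have idx k : k \in A -> exists2 a, a < size e & nth i e a = k.
  by rewrite -e_mem => ke; exists (index k e); rewrite ?index_mem ?nth_index.
have ie : i \in e by rewrite e_mem.
rewrite prev_nth ie.
case: e => // y p in ie e_uniq e_mem e_sorted lt_nth le_nth idx *.
have j_lt : index i p <= size p by exact: index_size.
rewrite (set_nth_default i) ?ltnS //.
have [Ei|ne] := eqVneq i y.
  left=> k /idx[a a_lt <-]; split; first by rewrite {1}Ei; apply: (le_nth 0 a).
  (* The head is not in the tail, so its index there is past the end and [prev]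
     reads the last entry. *)
  rewrite memNindex; last by rewrite Ei; case/andP: e_uniq.
  by apply: le_nth; rewrite -ltnS a_lt /=.
have ip : i \in p by move: ie; rewrite inE (negbTE ne).
have Ei : i = nth i (y :: p) (index i p).+1 by rewrite /= nth_index.
have sz : (index i p).+1 < size (y :: p) by rewrite /= ltnS index_mem.
have {}Ei : nat_of_ord i = nth i (y :: p) (index i p).+1 by rewrite -Ei.
right; split; first by rewrite Ei lt_nth // ltnSn.
move=> k /idx[a a_lt <-]; rewrite Ei => lt_ai; apply/le_nth.
rewrite (ltn_trans _ sz) // andbT leqNgt; apply: contraTN lt_ai => a_gt.
by rewrite -leqNgt le_nth // a_gt.
Qed.

Definition anti_excedances (n : nat) (u : 'I_n -> 'I_n) : {set 'I_n} :=
  [set q | u q < q]%SET.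

(** The value [g q] now standing at [q] belongs at s^-1 (g q).  Values only move
    to the right, cyclically, so these are the positions whose value has yet to
    pass from the last unsolved position to the first one. *)
Definition pending (n : nat) (g : guess n) (s : 'S_n) : {set 'I_n} :=
  anti_excedances (fun q => (s^-1)%g (g q)).

Lemma injective_shift_guess (n : nat) (g : guess n) (U : {set 'I_n}) :
  injective g -> injective (shift_guess g U).
Proof.
move=> g_inj.
have prevU i : i \notin U -> prev (enum (~: U)) i \notin U.
  move=> iU.
  by rewrite -finset.in_setC -mem_enum mem_prev mem_enum finset.in_setC.
move=> i j; rewrite !ffunE.
have [iU|iU] := boolP (i \in U); have [jU|jU] := boolP (j \in U).
- exact: g_inj.
- by move=> /g_inj E; have := prevU _ jU; rewrite -E iU.
- by move=> /g_inj E; have := prevU _ iU; rewrite E jU.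
by move=> /g_inj /(can_inj (next_prev (enum_uniq _))).
Qed.

(** Targets of misplaced values are unsolved positions, and a value moves to the
    next unsolved position, so it never passes its target without stopping
    there.  The value at the last unsolved position is pending and stops being
    so; every other value that is pending after the shift was so before. *)
Lemma card_pending_shift (n : nat) (g : guess n) (s : 'S_n) :
  injective g -> ~ g =1 s ->
  #|pending (shift_guess g (feedback g s)) s| < #|pending g s|.
Proof.
move=> g_inj g_s; set U := feedback g s; set R := (~: U)%SET.
pose u q := (s^-1)%g (g q).
have u_inj : injective u by move=> a b /perm_inj/g_inj.
have inR q : (q \in R) = (u q != q).
  rewrite finset.in_setC inE /u; congr negb.
  apply/eqP/eqP => [->|E]; first by rewrite permK.
  by rewrite -{2}E permKV.
(* The target of a misplaced value is itself unsolved. *)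
have uR q : (u q \in R) = (q \in R) by rewrite !inR (inj_eq u_inj).
have prevR i : i \in R -> prev (enum R) i \in R.
  by move=> iR; rewrite -mem_enum mem_prev mem_enum.
have shiftE i : (s^-1)%g (shift_guess g U i) =
    if i \in R then u (prev (enum R) i) else u i.
  by rewrite ffunE finset.in_setC; case: (i \in U).
have [m mR m_max] : exists2 m, m \in R & forall k, k \in R -> k <= m.
  have [i0 i0R] : exists i, i \in R.
    apply: contrapT => R0; apply: g_s => i; apply/eqP.
    apply: contra_notT R0 => gi.
    by exists i; rewrite !inE.
  by case: (arg_maxnP (fun k : 'I_n => k : nat) i0R) => m mR m_max; exists m.
(* [prev] maps the positions pending after the shift injectively into those
   pending before, and misses the last unsolved position [m]. *)
have prevD i : i \in pending (shift_guess g U) s ->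
    prev (enum R) i \in pending g s :\ m.
  rewrite inE shiftE; have [iR|] := boolP (i \in R); last first.
    by rewrite inR negbK => /eqP ->; rewrite ltnn.
  have jR := prevR i iR; have ujR : u (prev (enum R) i) \in R by rewrite uR.
  move=> uj_lt; rewrite !inE.
  (* A value that has wrapped to the first unsolved position is no longer
     pending, which excludes the first case. *)
  case: (prev_enumP iR) => [/(_ _ ujR)[]|[j_lt j_max]].
    by rewrite leqNgt uj_lt.
  apply/andP; split.
    by apply: contraTneq j_lt => ->; rewrite -leqNgt m_max.
  by rewrite ltn_neqAle j_max // andbT (inj_eq val_inj) -inR.
apply: leq_ltn_trans (_ : #|pending g s :\ m| < _).
  rewrite -(card_imset _ (can_inj (next_prev (enum_uniq R)))).
  by apply/subset_leq_card/fintype.subsetP => _ /imsetP[i iD ->]; exact: prevD.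
have mD : m \in pending g s.
  by rewrite inE ltn_neqAle (inj_eq val_inj) -inR mR m_max ?uR.
by rewrite [X in _ < X](cardsD1 m) mD.
Qed.

Lemma circular_shift_history (n : nat) (s : 'S_n) (k : nat) :
  circular_shift n (history (circular_shift n) s k.+1) =
  let g := circular_shift n (history (circular_shift n) s k) in
  shift_guess g (feedback g s).
Proof. by rewrite /= {1}/circular_shift foldl_rcons. Qed.

Lemma circular_shift_inj (n : nat) (s : 'S_n) (k : nat) :
  injective (circular_shift n (history (circular_shift n) s k)).
Proof.
elim: k => [|k IHk]; first by move=> i j; rewrite !ffunE.
by rewrite circular_shift_history /=; exact: injective_shift_guess.
Qed.

Lemma solves_within_leq (n : nat) (S : strategy n) (s : 'S_n) (a b : nat) :
  a <= b -> solves_within S s a -> solves_within S s b.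
Proof.
by move=> ab [j /andP[j0 ja] gj]; exists j; rewrite // j0 (leq_trans ja).
Qed.

(** The first guess is the identity, so it has as many pending values as s^-1
    has anti-excedances, and each unsuccessful round removes one. *)
Lemma circular_shift_solves (n : nat) (s : 'S_n) :
  solves_within (circular_shift n) s #|anti_excedances (s^-1)%g|.+1.
Proof.
pose g k := circular_shift n (history (circular_shift n) s k).
have H k : solves_within (circular_shift n) s k \/
    #|pending (g k) s| + k <= #|anti_excedances (s^-1)%g|.
  elim: k => [|k [H|H]].
  - right; rewrite addn0; apply/subset_leq_card/fintype.subsetP => q.
    by rewrite !inE /g /= ffunE.
  - by left; apply: solves_within_leq H.
  have [Eg|ne] := pselect (g k =1 s).
    by left; exists k.+1; rewrite ?leqnn.
  right; apply: leq_trans H; rewrite addnS ltn_add2r.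
  rewrite /g circular_shift_history card_pending_shift //.
  exact: circular_shift_inj.
case: (H #|anti_excedances (s^-1)%g|.+1) => // /(leq_trans (leq_addl _ _)).
by rewrite ltnn.
Qed.

(** The symmetry behind the palindromic Eulerian numbers.  Products of
    permutations are read from left to right: the successor is applied last. *)
Definition flip (n : nat) (s : 'S_n) : 'S_n := (s^-1 * perm (@ordS_inj n))%g.

Lemma flip_inj (n : nat) : injective (@flip n).
Proof. by move=> s t /mulIg /invg_inj. Qed.

(** If s^-1 q <> n - 1 then s^-1(q) + 1 > q holds exactly when s^-1 q >= q, so
    the excedances of [flip s], equinumerous with the anti-excedances of its
    inverse, are the non-anti-excedances of s^-1, except for the q sent to
    n - 1 by s^-1: there [flip s] has value 0. *)
Lemma card_anti_excedances_flip (n : nat) (s : 'S_n) :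
  0 < n ->
  #|anti_excedances ((flip s)^-1)%g| + #|anti_excedances (s^-1)%g| = n.-1.
Proof.
case: n s => // n s _ /=.
pose A := [set q : 'I_n.+1 | q < flip s q]%SET.
have -> : #|anti_excedances ((flip s)^-1)%g| = #|A|.
  rewrite -(card_imset A (@perm_inj _ (flip s))); apply: eq_card => p.
  apply/idP/imsetP => [|[q qA ->]]; last first.
    by rewrite inE permK; move: qA; rewrite inE.
  rewrite inE => lt_p; exists ((flip s)^-1 p)%g; last by rewrite permKV.
  by rewrite inE permKV.
have flipE q : flip s q = ((s^-1)%g q).+1 %% n.+1 :> nat by rewrite permM permE.
have maxA : s ord_max \notin A by rewrite inE flipE permK modnn.
(* s ord_max is the q with s^-1 q = n - 1. *)
have DE : anti_excedances (s^-1)%g = (~: (s ord_max |: A))%SET.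
  apply/setP => q; rewrite !inE flipE negb_or.
  have [->|ne] := eqVneq q (s ord_max).
    by rewrite permK ltnNge -ltnS ltn_ord.
  have lt_n : (s^-1)%g q < n.
    rewrite ltn_neqAle -ltnS ltn_ord andbT; apply: contraNneq ne => E.
    by rewrite -[q](permKV s); apply/eqP; congr (s _); apply: val_inj.
  by rewrite modn_small // -leqNgt.
have := cardsC (s ord_max |: A); rewrite -DE cardsU1 maxA card_ord add1n addSn.
by case.
Qed.

(** By [flip], the bound n! - #|solved (circular_shift n) (n - r)| on any
    strategy is at most the number of permutations that CircularShift is known
    to solve within [r] guesses. *)
Theorem card_solved_circular_shift (n : nat) (S : strategy n) (r : nat) :
  0 < n -> 0 < r -> #|solved S r| <= #|solved (circular_shift n) r|.
Proof.
move=> n0 r0.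
pose few k := [set s : 'S_n | #|anti_excedances (s^-1)%g| < k]%SET.
have CS k : #|few k| <= #|solved (circular_shift n) k|.
  apply/subset_leq_card/fintype.subsetP => s; rewrite !inE => lt_k.
  exact: solves_within_leq lt_k (circular_shift_solves s).
apply: leq_trans (CS r).
have flip_card s := card_anti_excedances_flip s n0.
have [nr|rn] := leqP n r.
  (* There are never more than n - 1 anti-excedances. *)
  suff -> : few r = [set: 'S_n]%SET by rewrite cardsT max_card.
  apply/setP => s; rewrite !inE; apply: leq_trans nr.
  by rewrite -[X in _ < X](prednK n0) ltnS -(flip_card s) leq_addl.
have few_flip : #|few r| + #|few (n - r)| = n`!.
  rewrite -(card_preimset (few (n - r)) (@flip_inj n)).
  have -> : (@flip n @^-1: few (n - r) = ~: few r)%SET.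
    apply/setP => s; rewrite !inE -leqNgt.
    move: (flip_card s) r0 rn n0; move: #|_| #|_| => x y; lia.
  by rewrite cardsC card_Sn.
rewrite -(leq_add2r #|few (n - r)|) few_flip.
apply: leq_trans (card_solved_complementary S (circular_shift n) r0 _ _).
- by rewrite leq_add2l.
- by rewrite subn_gt0.
- by rewrite subnKC // ltnW.
Qed.

(** * Random secrets and random strategies *)

Local Open Scope classical_set_scope.
Local Open Scope ring_scope.

(** The play against a fixed secret depends on [S] only through its answers to
    countably many lists, so its events lie in the sigma-algebra to which the
    independence hypothesis applies. *)
Lemma measurable_history (d : measure_display) (T : measurableType d)
    (n : nat) (S : T -> strategy n) (s : 'S_n) (k : nat) (h : seq {set 'I_n}) :
  (strategy_cylinders S).-sigma.-measurable [set t | history (S t) s k = h].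
Proof.
elim: k h => [|k IHk] h /=.
  have [<-|ne] := eqVneq ([::] : seq {set 'I_n}) h.
    by rewrite (_ : [set _ | _] = setT) //; apply/seteqP.
  rewrite (_ : [set _ | _] = set0) //; apply/seteqP; split=> // t /eqP.
  by rewrite (negbTE ne).
rewrite (_ : [set _ | _] = \bigcup_(hg : seq {set 'I_n} * guess n)
    (if rcons hg.1 (feedback hg.2 s) == h
     then [set t | history (S t) s k = hg.1] `&` [set t | S t hg.1 = hg.2]
     else set0)).
  apply: countable_bigcupT_measurable; first exact: countableP.
  move=> [h' g] /=; case: ifP => // _; apply: measurableI => //.
  by apply: sub_sigma_algebra; exists h', g.
apply/seteqP; split=> [t <-|t [[h' g] _] /=].
  by exists (history (S t) s k, S t (history (S t) s k)) => //=; rewrite eqxx.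
by case: eqP => [<-|//] [-> ->].
Qed.

Lemma measurable_solves_within (d : measure_display) (T : measurableType d)
    (n : nat) (S : T -> strategy n) (s : 'S_n) (r : nat) :
  (strategy_cylinders S).-sigma.-measurable [set t | solves_within (S t) s r].
Proof.
rewrite (_ : [set _ | _] = \bigcup_(jhg : nat * seq {set 'I_n} * guess n)
    (if (0 < jhg.1.1 <= r)%N && [forall i, jhg.2 i == s i]
     then [set t | history (S t) s jhg.1.1.-1 = jhg.1.2] `&`
          [set t | S t jhg.1.2 = jhg.2]
     else set0)).
  apply: countable_bigcupT_measurable; first exact: countableP.
  move=> [[j h] g] /=; case: ifP => // _; apply: measurableI.
    exact: measurable_history.
  by apply: sub_sigma_algebra; exists h, g.
apply/seteqP; split=> [t [j jr gs]|t [[[j h] g] _] /=].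
  exists (j, history (S t) s j.-1, nth_guess (S t) s j) => //=.
  by rewrite jr (_ : [forall i, _]) //; apply/forallP => i; apply/eqP.
case: ifP => [/andP[jr /forallP gs] [hh gg]|//].
by exists j => // i; rewrite /nth_guess hh gg (eqP (gs i)).
Qed.

Section Averaging.
Context {R : realType} {d : measure_display} {T : measurableType d}.
Variables (P : probability T R) (n : nat) (secret : T -> 'S_n).
Hypothesis secret_unif : uniform_secret P secret.

(** Total probability over the value of the secret. *)
Lemma solve_probability_sum (S : T -> strategy n) (r : nat) :
  (forall s, measurable [set t | solves_within (S t) s r]) ->
  solve_probability P secret S r =
  (\sum_(s : 'S_n)
     P (secret @^-1` [set s] `&` [set t | solves_within (S t) s r]))%E.
Proof.
move=> mS; rewrite /solve_probability.
rewrite (_ : [set t | _] = \bigcup_(s in [set: 'S_n])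
   (secret @^-1` [set s] `&` [set t | solves_within (S t) s r])); last first.
  by apply/seteqP; split=> [t St|t [s _ [<-]]//]; exists (secret t).
have setT_enum : [set: 'S_n] = [set` index_enum 'S_n].
  by apply/seteqP; split=> // s _ /=; rewrite mem_index_enum.
rewrite measure_fin_bigcup //.
- by rewrite setT_enum -fsbig_seq // index_enum_uniq.
- by rewrite setT_enum; exact: finite_finset.
- by move=> s s' _ _ [t [[<- _] [<- _]]].
- by move=> s _; apply: measurableI => //; exact: (secret_unif s).1.
Qed.

Lemma solve_probability_deterministic (F : strategy n) (r : nat) :
  solve_probability P secret (fun=> F) r = (#|solved F r|%:R / n`!%:R)%:E.
Proof.
have const_event (s : 'S_n) : [set _ : T | solves_within F s r] =
    if s \in solved F r then setT else set0.
  by rewrite inE; apply/seteqP; case: asboolP => H; split.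
rewrite solve_probability_sum => [|s]; last by rewrite const_event; case: ifP.
rewrite -sum1_card natr_sum [in RHS]big_mkcond mulr_suml -sumEFin.
apply: eq_bigr => s _; rewrite const_event; case: ifP => _.
  by rewrite setIT (secret_unif s).2 mul1r.
by rewrite setI0 measure0 mul0r.
Qed.

(** By independence the probability is 1 / n! times the sum over [s] of
    P (S solves s), and that sum is the expectation of #|solved S r|. *)
Lemma solve_probability_le (S : T -> strategy n) (r c : nat) :
  random_strategy S -> independent_of_secret P secret S ->
  (forall t, #|solved (S t) r| <= c)%N ->
  (solve_probability P secret S r <= (c%:R / n`!%:R)%:E)%E.
Proof.
move=> S_random S_indep S_le.
pose A s := [set t | solves_within (S t) s r].
have mA s : d.-measurable (A s).
  have : (strategy_cylinders S).-sigma.-measurable (A s).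
    exact: measurable_solves_within.
  by apply: smallest_sub => //; exact: sigma_algebra_measurable.
have -> : solve_probability P secret S r =
    ((n`!%:R^-1)%:E * \sum_(s : 'S_n) P (A s))%E.
  rewrite solve_probability_sum // ge0_sume_distrr //.
  apply: eq_bigr => s _; rewrite S_indep ?(secret_unif s).2 //.
  exact: measurable_solves_within.
rewrite mulrC EFinM; apply: lee_wpmul2l; first by rewrite lee_fin invr_ge0.
have -> : (\sum_(s : 'S_n) P (A s) =
           \int[P]_t \sum_(s : 'S_n) (\1_(A s) t)%:E)%E.
  rewrite ge0_integral_sum //.
  - by apply: eq_bigr => s _; rewrite integral_indic ?setIT.
  - by move=> s; apply/measurable_EFinP; exact: measurable_indic.
apply: (@le_trans _ _ (\int[P]_t (cst (c%:R : R)%:E t))%E); last first.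
  have PT : P [set: T] = 1%E by exact: probability_setT.
  by rewrite integral_cst // -[leRHS]mule1 -PT.
apply: ge0_le_integral => //.
- by move=> t _; apply: sume_ge0 => s _; rewrite lee_fin.
- apply: emeasurable_sum => s; apply/measurable_EFinP.
  exact: measurable_indic.
move=> t _; rewrite sumEFin lee_fin.
apply: (@le_trans _ _ (#|solved (S t) r|%:R)); last by rewrite ler_nat.
rewrite -sum1_card natr_sum [leRHS]big_mkcond ler_sum // => s _.
rewrite indicE inE /A /=; case: asboolP => H; first by rewrite mem_set.
by rewrite memNset.
Qed.

End Averaging.

Theorem theorem11 (R : realType) (n : nat) (hn : (1 <= n)%N)
    (d : measure_display) (T : measurableType d) (P : probability T R)
    (secret : T -> 'S_n) (hsecret : uniform_secret P secret)
    (S : T -> strategy n) (hS : random_strategy S)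
    (hindep : independent_of_secret P secret S)
    (r : nat) (hr : (1 <= r)%N) :
  (solve_probability P secret S r <=
   solve_probability P secret (fun _ : T => circular_shift n) r)%E.
Proof.
rewrite (solve_probability_deterministic hsecret).
apply: (solve_probability_le hsecret hS hindep) => t.
exact: card_solved_circular_shift.
Qed.
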